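(* For every commutative ring $R$ there is only a set of distinct Bousfield classes in the derived category $\mathcal{D}(R)$.
   Context: $\mathcal{D}(R)$ is the derived category of unbounded chain complexes of $R$-modules. The Bousfield class $\langle A\rangle$ of a chain complex $A$ is the class of all chain complexes $X$ such that the derived tensor product of $A$ and $X$ over $R$ is zero in $\mathcal{D}(R)$. ''There is only a set of distinct Bousfield classes'' means that the collection of classes $\langle A\rangle$, as $A$ ranges over all objects of $\mathcal{D}(R)$, can be indexed by a set, i.e. it is not a proper class. *)

(* Defs.v *)
From HB Require Import structures.
From mathcomp Require Import all_boot all_order all_algebra boolp.

Set Implicit Arguments.
Unset Strict Implicit.
Unset Printing Implicit Defensive.

Import GRing.Theory.
Local Open Scope ring_scope.
Local Open Scope quotient_scope.

(* Universe convention.  A set is a type living in the universe of the        *)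
(* carriers of R-modules (the same universe as the carriers of rings).  Since *)
(* a chain complex contains modules, the type of all chain complexes lives in *)
(* a strictly larger universe and is not a [small_type].                      *)
Definition small_type := Type@{GRing.Lmodule.axioms_.u0}.

(* (+)_(k : K) M k (x)_R N k, presented by the generators m (x) n, with       *)
(* m : M k and n : N k, and the bilinearity relations: finite formal sums of  *)
(* generators modulo the congruence they generate.  The universal property is *)
(* given by [tlift_pure] and [tensor_sum_ext].                                *)
Section TensorSum.
Variables (R : comPzRingType) (K : choiceType) (M N : K -> lmodType R).

Definition tpair (k : K) : choiceType := (M k * N k)%type.
Definition tgen : choiceType := {k : K & tpair k}.
Definition tg (k : K) (m : M k) (n : N k) : tgen := Tagged tpair (m, n).

Inductive tensor_rel : seq tgen -> seq tgen -> Prop :=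
| trel_refl s : tensor_rel s s
| trel_sym s t : tensor_rel s t -> tensor_rel t s
| trel_trans s t u : tensor_rel s t -> tensor_rel t u -> tensor_rel s u
| trel_cat s s' t t' :
    tensor_rel s s' -> tensor_rel t t' -> tensor_rel (s ++ t) (s' ++ t')
| trel_catC s t : tensor_rel (s ++ t) (t ++ s)
| trel_addl k (m m' : M k) (n : N k) :
    tensor_rel [:: tg (m + m') n] [:: tg m n; tg m' n]
| trel_addr k (m : M k) (n n' : N k) :
    tensor_rel [:: tg m (n + n')] [:: tg m n; tg m n']
| trel_scale k a (m : M k) (n : N k) :
    tensor_rel [:: tg (a *: m) n] [:: tg m (a *: n)]
| trel_zero k (n : N k) : tensor_rel [:: tg 0 n] [::].

Definition tensor_relb (s t : seq tgen) : bool := `[< tensor_rel s t >].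

Lemma tensor_relb_equiv : equiv_class_of tensor_relb.
Proof.
split=> [s|s t|t s u].
- exact/asboolP/trel_refl.
- by apply/asboolP/asboolP; exact: trel_sym.
- by move=> /asboolP st /asboolP tu; apply/asboolP; exact: trel_trans tu.
Qed.

Canonical tensor_equiv := EquivRelPack tensor_relb_equiv.

Definition tensor_sum := {eq_quot tensor_equiv}.
HB.instance Definition _ := Choice.on tensor_sum.
HB.instance Definition _ := EqQuotient.on tensor_sum.

Definition tclass (s : seq tgen) : tensor_sum := \pi_tensor_sum s.

Lemma tclassP s t : tensor_rel s t <-> tclass s = tclass t.
Proof.
by split=> [st|/eqmodP/asboolP//]; apply/eqmodP/asboolP.
Qed.

Lemma tclass_surj (x : tensor_sum) : exists s, x = tclass s.
Proof. by exists (repr x); rewrite /tclass reprK. Qed.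

Definition tgen_opp (g : tgen) : tgen := tg (- (tagged g).1) (tagged g).2.
Definition tgen_scale (a : R) (g : tgen) : tgen :=
  tg (a *: (tagged g).1) (tagged g).2.

Definition tensor_zero : tensor_sum := tclass [::].
Definition tensor_add (x y : tensor_sum) := tclass (repr x ++ repr y).
Definition tensor_opp (x : tensor_sum) := tclass (map tgen_opp (repr x)).
Definition tensor_scale (a : R) (x : tensor_sum) :=
  tclass (map (tgen_scale a) (repr x)).

Lemma trel_repr s : tensor_rel (repr (tclass s)) s.
Proof. by apply/tclassP; rewrite /tclass reprK. Qed.

Lemma tensor_addE s t : tensor_add (tclass s) (tclass t) = tclass (s ++ t).
Proof. by apply/tclassP/trel_cat; exact: trel_repr. Qed.

Fact tensor_addA : associative tensor_add.
Proof.
move=> x y z.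
case: (tclass_surj x) (tclass_surj y) (tclass_surj z) => s -> [t ->] [u ->].
by rewrite !tensor_addE catA.
Qed.

Fact tensor_addC : commutative tensor_add.
Proof.
move=> x y; case: (tclass_surj x) (tclass_surj y) => s -> [t ->].
by rewrite !tensor_addE; apply/tclassP/trel_catC.
Qed.

Fact tensor_add0 : left_id tensor_zero tensor_add.
Proof. by move=> x; case: (tclass_surj x) => s ->; rewrite tensor_addE. Qed.

Lemma trel_map (h : tgen -> tgen) :
  (forall k (m m' : M k) (n : N k),
    tensor_rel [:: h (tg (m + m') n)] [:: h (tg m n); h (tg m' n)]) ->
  (forall k (m : M k) (n n' : N k),
    tensor_rel [:: h (tg m (n + n'))] [:: h (tg m n); h (tg m n')]) ->
  (forall k a (m : M k) (n : N k),
    tensor_rel [:: h (tg (a *: m) n)] [:: h (tg m (a *: n))]) ->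
  (forall k (n : N k), tensor_rel [:: h (tg 0 n)] [::]) ->
  forall s t, tensor_rel s t -> tensor_rel (map h s) (map h t).
Proof.
move=> hl hr hs h0 s t.
elim=> {s t} // [s|s t _|s t u _ st _ tu|s s' t t' _ IHs _ IHt|s t].
- exact: trel_refl.
- exact: trel_sym.
- exact: trel_trans tu.
- by rewrite !map_cat; exact: trel_cat.
- by rewrite !map_cat; exact: trel_catC.
Qed.

Lemma tensor_oppE s : tensor_opp (tclass s) = tclass (map tgen_opp s).
Proof.
apply/tclassP/trel_map/trel_repr => [k m m' n|k m n n'|k a m n|k n].
- by rewrite /tgen_opp /= opprD; exact: trel_addl.
- exact: trel_addr.
- by rewrite /tgen_opp /= -scalerN; exact: trel_scale.
- by rewrite /tgen_opp /= oppr0; exact: trel_zero.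
Qed.

Fact tensor_addN : left_inverse tensor_zero tensor_opp tensor_add.
Proof.
move=> x; case: (tclass_surj x) => s ->; rewrite tensor_oppE.
elim: s => [|[k [m n]] s IHs]; first by rewrite tensor_add0.
rewrite tensor_addE; apply/tclassP => /=.
rewrite -[_ :: _ ++ _]/([:: _] ++ (_ ++ ([:: _] ++ _))).
apply: (@trel_trans _ (([:: tg (- m) n] ++ [:: tg m n]) ++
                       ([seq tgen_opp i | i <- s] ++ s))).
  rewrite -[X in tensor_rel _ X]catA; apply: trel_cat; first exact: trel_refl.
  rewrite !catA; apply: trel_cat; last exact: trel_refl.
  exact: trel_catC.
rewrite -[[::]]/([::] ++ [::]); apply: trel_cat; last first.
  by apply/tclassP; rewrite -tensor_addE.
apply: trel_trans (trel_sym (trel_addl _ _ _)) _; rewrite addNr.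
exact: trel_zero.
Qed.

HB.instance Definition _ :=
  GRing.isZmodule.Build tensor_sum tensor_addA tensor_addC tensor_add0
    tensor_addN.

(* The elementary tensor m (x) n in the k-th summand *)
Definition tpure (k : K) (m : M k) (n : N k) : tensor_sum := tclass [:: tg m n].

Lemma tclass_cat s t : tclass (s ++ t) = tclass s + tclass t.
Proof. by rewrite -tensor_addE. Qed.

Lemma tclassE s :
  tclass s = \sum_(g <- s) tpure (tagged g).1 (tagged g).2.
Proof.
elim: s => [|[k [m n]] s IHs]; first by rewrite big_nil.
by rewrite big_cons -cat1s tclass_cat IHs.
Qed.

Lemma tensor_scaleE a s :
  tensor_scale a (tclass s) = tclass (map (tgen_scale a) s).
Proof.
apply/tclassP/trel_map/trel_repr => [k m m' n|k m n n'|k b m n|k n].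
- by rewrite /tgen_scale /= scalerDr; exact: trel_addl.
- exact: trel_addr.
- rewrite /tgen_scale /= scalerA mulrC -scalerA; exact: trel_scale.
- by rewrite /tgen_scale /= scaler0; exact: trel_zero.
Qed.

Lemma tpureDl k (m m' : M k) (n : N k) :
  tpure (m + m') n = tpure m n + tpure m' n.
Proof. by rewrite -tclass_cat; apply/tclassP/trel_addl. Qed.

Lemma tpureDr k (m : M k) (n n' : N k) :
  tpure m (n + n') = tpure m n + tpure m n'.
Proof. by rewrite -tclass_cat; apply/tclassP/trel_addr. Qed.

Fact tensor_scaleDr : right_distributive tensor_scale +%R.
Proof.
move=> a x y; case: (tclass_surj x) (tclass_surj y) => s -> [t ->].
by rewrite -tclass_cat !tensor_scaleE map_cat tclass_cat.
Qed.

Fact tensor_scaleDl x : {morph tensor_scale^~ x : a b / a + b}.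
Proof.
move=> a b; case: (tclass_surj x) => s ->; rewrite !tensor_scaleE !tclassE.
rewrite !big_map -big_split; apply: eq_bigr => -[k [m n]] _ /=.
by rewrite scalerDl tpureDl.
Qed.

Fact tensor_scaleA a b x :
  tensor_scale a (tensor_scale b x) = tensor_scale (a * b) x.
Proof.
case: (tclass_surj x) => s ->; rewrite !tensor_scaleE -map_comp.
by congr tclass; apply: eq_map => -[k [m n]]; rewrite /= /tgen_scale /= scalerA.
Qed.

Fact tensor_scale1 : left_id 1 tensor_scale.
Proof.
move=> x; case: (tclass_surj x) => s ->; rewrite tensor_scaleE.
congr tclass; rewrite -[RHS]map_id; apply: eq_map => -[k [m n]].
by rewrite /tgen_scale /= scale1r.
Qed.

HB.instance Definition _ :=
  GRing.Zmodule_isLmodule.Build R tensor_sum tensor_scaleA tensor_scale1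
    tensor_scaleDr tensor_scaleDl.

Lemma tpureZl k a (m : M k) (n : N k) : tpure (a *: m) n = a *: tpure m n.
Proof. by rewrite [RHS]tensor_scaleE. Qed.

Lemma tpureZr k a (m : M k) (n : N k) : tpure m (a *: n) = a *: tpure m n.
Proof. by rewrite -tpureZl; apply/esym/tclassP/trel_scale. Qed.

Lemma tensor_sum_gen (x : tensor_sum) :
  x = \sum_(g <- repr x) tpure (tagged g).1 (tagged g).2.
Proof. by rewrite -tclassE /tclass reprK. Qed.

Section Lift.
Variable V : lmodType R.

Definition bilinear_family (f : forall k, M k -> N k -> V) : Prop :=
  (forall k n, linear (fun m => f k m n)) /\ (forall k m, linear (f k m)).

Definition tlift (f : forall k, M k -> N k -> V) (x : tensor_sum) : V :=
  \sum_(g <- repr x) f (tag g) (tagged g).1 (tagged g).2.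

Variables (f : forall k, M k -> N k -> V) (f_bil : bilinear_family f).

Lemma tlift_class s :
  tlift f (tclass s) = \sum_(g <- s) f (tagged g).1 (tagged g).2.
Proof.
case: f_bil => fl fr; rewrite /tlift; move: (trel_repr s).
move: (repr _) => t.
elim=> {s t} // [s t u _ -> _ -> //|s s' t t' _ es _ et|s t|||k a m n|k n].
- by rewrite !big_cat es et.
- by rewrite !big_cat /= addrC.
- move=> k m m' n; rewrite !big_cons !big_nil /= !addr0.
  by have := fl k n 1 m m'; rewrite !scale1r.
- move=> k m n n'; rewrite !big_cons !big_nil /= !addr0.
  by have := fr k m 1 n n'; rewrite !scale1r.
- rewrite !big_cons !big_nil /= !addr0.
  have f0l : f 0 n = 0.
    by apply: (addrI (f 0 n)); have := fl k n 1 0 0;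
       rewrite !scale1r !addr0 => <-.
  have f0r : f m 0 = 0.
    by apply: (addrI (f m 0)); have := fr k m 1 0 0;
       rewrite !scale1r !addr0 => <-.
  have := fl k n a m 0; have := fr k m a n 0.
  by rewrite !addr0 f0l f0r !addr0 => -> ->.
- rewrite big_cons big_nil /= addr0.
  by apply: (addrI (f 0 n)); have := fl k n 1 0 0;
     rewrite !scale1r !addr0 => <-.
Qed.

Lemma tlift_pure k (m : M k) (n : N k) : tlift f (tpure m n) = f m n.
Proof. by rewrite tlift_class big_cons big_nil addr0. Qed.

Lemma tlift_linear : linear (tlift f).
Proof.
case: (f_bil) => fl _ a x y.
case: (tclass_surj x) (tclass_surj y) => s -> [t ->].
rewrite [_ *: _]tensor_scaleE -tclass_cat !tlift_class big_cat /= big_map.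
congr (_ + _); rewrite scaler_sumr; apply: eq_bigr => -[k [m n]] _ /=.
have f0l : f 0 n = 0.
  by apply: (addrI (f 0 n)); have := fl k n 1 0 0;
     rewrite !scale1r !addr0 => <-.
by have := fl k n a m 0; rewrite !addr0 f0l addr0.
Qed.

End Lift.

Lemma tensor_sum_ext (V : lmodType R) (h h' : {linear tensor_sum -> V}) :
  (forall k (m : M k) (n : N k), h (tpure m n) = h' (tpure m n)) -> h =1 h'.
Proof.
move=> hh' x; rewrite [x]tensor_sum_gen !raddf_sum.
by apply: eq_bigr => g _; exact: hh'.
Qed.

End TensorSum.

(* Unbounded chain complexes.  The differential is indexed by its source and  *)
(* target degrees, and vanishes unless it lowers the degree by 1; this avoids *)
(* casts between, e.g., degrees n and n + 1 - 1.                              *)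
Record complex (R : pzRingType) := Complex {
  cobj :> int -> lmodType R;
  diff : forall i j : int, {linear cobj i -> cobj j};
  diff_shape : forall (i j : int) (x : cobj i), i != j + 1 -> diff i j x = 0;
  diffK : forall (i j k : int) (x : cobj i), diff j k (diff i j x) = 0
}.

Section Complexes.
Variable R : pzRingType.
Implicit Types C D : complex R.

Definition cycle C (n : int) (z : C n) : Prop := diff C n (n - 1) z = 0.
Definition boundary C (n : int) (z : C n) : Prop :=
  exists x : C (n + 1), diff C (n + 1) n x = z.

Definition acyclic C : Prop := forall n (z : C n), cycle z -> boundary z.

Record chain_map C D := ChainMap {
  cmap :> forall n : int, {linear C n -> D n};
  cmap_diff : forall (i j : int) (x : C i),
    cmap j (diff C i j x) = diff D i j (cmap i x)
}.

(* H_n(f) is injective and surjective for all n *)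
Definition quasi_iso C D (f : chain_map C D) : Prop :=
  forall n : int,
    (forall z : C n, cycle z -> boundary (f n z) -> boundary z) /\
    (forall w : D n, cycle w ->
       exists z : C n, cycle z /\ boundary (w - f n z)).

(* Isomorphism in the derived category D(R), the localisation of the category *)
(* of chain complexes at the quasi-isomorphisms: a finite zigzag of           *)
(* quasi-isomorphisms.                                                        *)
Inductive derived_iso : complex R -> complex R -> Prop :=
| derived_iso_qis C D (f : chain_map C D) : quasi_iso f -> derived_iso C D
| derived_iso_sym C D : derived_iso C D -> derived_iso D C
| derived_iso_trans C D E :
    derived_iso C D -> derived_iso D E -> derived_iso C E.

Definition zero_complex : complex R :=
  @Complex R (fun _ => 'rV[R]_0) (fun _ _ => \0)
    (fun _ _ _ _ => erefl) (fun _ _ _ _ => erefl).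

Definition derived_zero C : Prop := derived_iso C zero_complex.

End Complexes.

Lemma sign_pred (R : pzRingType) (i : int) :
  (-1) ^+ `|i - 1|%N = - (-1) ^+ `|i|%N :> R.
Proof.
case: i => [[|n]|n].
- by rewrite sub0r abszN expr1 expr0.
- have -> : n.+1%:Z - 1 = n by rewrite intS addrAC subrr add0r.
  by rewrite !absz_nat exprS mulN1r opprK.
- have -> : Negz n - 1 = - n.+2%:Z by rewrite NegzE -opprD addrC -intS.
  by rewrite abszN absz_nat exprS mulN1r.
Qed.

Section TensorComplex.
Variables (R : comPzRingType) (P X : complex R).

Definition antidiag (n : int) : choiceType :=
  {ij : int * int | ij.1 + ij.2 == n}.

(* (P (x) X)_n = (+)_(i + j = n) P_i (x)_R X_j *)
Definition tensor_obj (n : int) : lmodType R :=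
  tensor_sum (fun ij : antidiag n => P (val ij).1)
             (fun ij : antidiag n => X (val ij).2).

(* p (x) x as an element of (P (x) X)_n; the junk value 0 is used when        *)
(* i + j != n.                                                                *)
Definition ctens (n i j : int) (p : P i) (x : X j) : tensor_obj n :=
  match @idP (i + j == n) with
  | ReflectT e => @tpure R (antidiag n) (fun ij => P (val ij).1)
                    (fun ij => X (val ij).2) (exist _ (i, j) e) p x
  | ReflectF _ => 0
  end.

(* d (p (x) x) = dp (x) x + (-1)^i p (x) dx for p in degree i *)
Definition tensor_diff_gen (n m : int) (ij : antidiag n)
    (p : P (val ij).1) (x : X (val ij).2) : tensor_obj m :=
  let: i := (val ij).1 in
  let: j := (val ij).2 in
  if n == m + 1 then
    ctens m (diff P i (i - 1) p) x +
    (-1) ^+ `|i|%N *: ctens m p (diff X j (j - 1) x)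
  else 0.

Lemma ctensE n (ij : antidiag n) (p : P (val ij).1) (x : X (val ij).2) :
  tpure (M := fun ij : antidiag n => P (val ij).1)
        (N := fun ij : antidiag n => X (val ij).2) p x = ctens n p x.
Proof.
move: ij p x => [[i j] /= e] p x; rewrite /ctens.
by case: {-}_ / idP => [e'|/(_ e)//]; rewrite (bool_irrelevance e e').
Qed.

Lemma ctens_linearl n i j (x : X j) : linear (fun p : P i => ctens n p x).
Proof.
move=> a p p'; rewrite /ctens; case: {-}_ / idP => e; last first.
  by rewrite scaler0 addr0.
by rewrite tpureDl tpureZl.
Qed.

Lemma ctens_linearr n i j (p : P i) : linear (fun x : X j => ctens n p x).
Proof.
move=> a x x'; rewrite /ctens; case: {-}_ / idP => e; last first.
  by rewrite scaler0 addr0.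
by rewrite tpureDr tpureZr.
Qed.

Lemma ctens_addl n i j (p p' : P i) (x : X j) :
  ctens n (p + p') x = ctens n p x + ctens n p' x.
Proof. by have := ctens_linearl n x 1 p p'; rewrite !scale1r. Qed.

Lemma ctens_addr n i j (p : P i) (x x' : X j) :
  ctens n p (x + x') = ctens n p x + ctens n p x'.
Proof. by have := ctens_linearr n p 1 x x'; rewrite !scale1r. Qed.

Lemma ctens0l n i j (x : X j) : ctens n (0 : P i) x = 0.
Proof. by apply: (addrI (ctens n (0 : P i) x)); rewrite addr0 -ctens_addl addr0. Qed.

Lemma ctens0r n i j (p : P i) : ctens n p (0 : X j) = 0.
Proof. by apply: (addrI (ctens n p (0 : X j))); rewrite addr0 -ctens_addr addr0. Qed.

Lemma ctensZl n i j a (p : P i) (x : X j) :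
  ctens n (a *: p) x = a *: ctens n p x.
Proof. by have := ctens_linearl n x a p 0; rewrite !addr0 ctens0l addr0. Qed.

Lemma ctensZr n i j a (p : P i) (x : X j) :
  ctens n p (a *: x) = a *: ctens n p x.
Proof. by have := ctens_linearr n p a x 0; rewrite !addr0 ctens0r addr0. Qed.

Lemma tensor_diff_gen_bilinear n m : bilinear_family (@tensor_diff_gen n m).
Proof.
split=> ij y a u v; rewrite /tensor_diff_gen.
  case: eqP => _; last by rewrite scaler0 addr0.
  rewrite linearP !ctens_linearl !scalerDr !scalerA [_ * a]mulrC.
  by rewrite addrACA.
case: eqP => _; last by rewrite scaler0 addr0.
rewrite linearP !ctens_linearr !scalerDr !scalerA [_ * a]mulrC.
by rewrite addrACA.
Qed.

Definition tensor_diff_fun (n m : int) : tensor_obj n -> tensor_obj m :=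
  tlift (@tensor_diff_gen n m).

HB.instance Definition _ n m :=
  GRing.isLinear.Build R (tensor_obj n) (tensor_obj m) _
    (@tensor_diff_fun n m) (tlift_linear (tensor_diff_gen_bilinear n m)).

Definition tensor_diff (n m : int) : {linear tensor_obj n -> tensor_obj m} :=
  @tensor_diff_fun n m.

Lemma tensor_diff_ctens n m i j (p : P i) (x : X j) :
  i + j = n -> n = m + 1 ->
  tensor_diff n m (ctens n p x) =
    ctens m (diff P i (i - 1) p) x +
    (-1) ^+ `|i|%N *: ctens m p (diff X j (j - 1) x).
Proof.
move=> e nm; have e' : (i, j).1 + (i, j).2 == n by apply/eqP.
rewrite -(ctensE (ij := exist _ (i, j) e')) /=.
rewrite /tensor_diff_fun (tlift_pure (tensor_diff_gen_bilinear n m)).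
by move/eqP: nm => nm; rewrite /tensor_diff_gen nm.
Qed.

Lemma tensor_diff_shape n m (x : tensor_obj n) :
  n != m + 1 -> tensor_diff n m x = 0.
Proof.
move=> nm; apply: (@tensor_sum_ext _ _ _ _ _ (tensor_diff n m) \0).
move=> ij p y; rewrite /= /tensor_diff_fun.
rewrite (tlift_pure (tensor_diff_gen_bilinear n m)).
by rewrite /tensor_diff_gen (negPf nm).
Qed.

Lemma tensor_diffK n m l (x : tensor_obj n) :
  tensor_diff m l (tensor_diff n m x) = 0.
Proof.
have [nm|nm] := eqVneq n (m + 1); last first.
  by rewrite (tensor_diff_shape _ nm) linear0.
have [ml|ml] := eqVneq m (l + 1); last by rewrite tensor_diff_shape.
pose dd : {linear tensor_obj n -> tensor_obj l} :=
  (tensor_diff m l \o tensor_diff n m).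
apply: (@tensor_sum_ext _ _ _ _ _ dd \0) => -[[i j] e] p y.
have ij : i + j = n := eqP e.
rewrite (ctensE (ij := exist _ (i, j) e)) /=.
rewrite [X in _ (X : tensor_obj m)]tensor_diff_ctens // linearD linearZ.
have e1 : i - 1 + j = m by rewrite addrAC ij nm addrK.
have e2 : i + (j - 1) = m by rewrite addrA ij nm addrK.
rewrite /= !(tensor_diff_ctens _ _ _ ml) // !diffK ctens0l ctens0r.
rewrite add0r scaler0 addr0 -scalerDl.
by rewrite sign_pred addNr scale0r.
Qed.

Definition tensor_complex : complex R :=
  Complex tensor_diff_shape tensor_diffK.

End TensorComplex.

Section Bousfield.
Variable R : comPzRingType.
Implicit Types A P X Y : complex R.

Definition K_flat P : Prop :=
  forall Y, acyclic Y -> acyclic (tensor_complex P Y).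

(* T represents A (x)^L X: it is isomorphic in D(R) to P (x) X for a K-flat   *)
(* resolution P -> A.  Every complex has such a resolution, and T is unique   *)
(* up to isomorphism in D(R).                                                 *)
Definition is_derived_tensor A X T : Prop :=
  exists (P : complex R) (f : chain_map P A),
    [/\ K_flat P, quasi_iso f & derived_iso T (tensor_complex P X)].

Definition bousfield_class A : complex R -> Prop :=
  fun X => exists T, is_derived_tensor A X T /\ derived_zero T.

Definition same_bousfield_class A B : Prop :=
  forall X, bousfield_class A X <-> bousfield_class B X.

End Bousfield.

(* Main.v *)
Require Import Defs.
From HB Require Import structures.
From mathcomp Require Import all_boot all_order all_algebra.
From mathcomp Require Import boolp.

(** The argument is Ohkawa's.  Fix a complex P.  An element of (P (x) X)_n is a
finite sum of tensors p (x) x, so it can be written as a word in letters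
p (x) a where a is a natural number serving as a name for an element of X.
Whether such a word is a cycle, or a boundary, depends on X only through the
equations x + y = z, r x = y and d x = y holding between finitely many named
elements.  These equations form a diagram: some relations on the natural
numbers, hence an element of a small type.  The profile of a word records the
diagrams that prove it to be a cycle or a boundary, and the spectrum of P is
the set of profiles of its words.

If every profile of P is a profile of P', and P' (x) X is acyclic, then so is
P (x) X ([spectrum_acyclic]).  Let z be a cycle of P (x) X.  Naming finitely
many elements of X yields a word for z and a diagram that proves it to be a
cycle.  A word over P' with the same profile is then a cycle of P' (x) X, hence
a boundary there; after naming finitely many further elements of X, the diagram
proves this word to be a boundary.  By equality of profiles it also proves the
first word to be a boundary, so z is one.  This needs soundness of proofs from
diagrams ([derivable_value], [leibniz_value]) and compactness: an equation in
P (x) X involves only finitely many elements of X ([eventually_derivable],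
[eventually_leibniz]).

To pass from P to a Bousfield class, attach to A the set of the spectra of all
its K-flat resolutions.  A complex X lies in the class of A exactly when P (x) X
is acyclic for some K-flat resolution P of A ([bousfield_classP]), so this set
determines the class.  Profiles, spectra and sets of spectra are iterated
predicates on a small type and therefore range over a small type themselves. *)
Set Implicit Arguments.
Unset Strict Implicit.
Unset Printing Implicit Defensive.

Import GRing.Theory.
Local Open Scope ring_scope.

(** * Acyclicity in the derived category *)
Section Acyclic.
Variable R : pzRingType.
Implicit Types C D : complex R.

Lemma cycle_cmap C D (f : chain_map C D) n (z : C n) :
  Defs.cycle z -> Defs.cycle (f n z).
Proof. by rewrite /Defs.cycle -cmap_diff => ->; rewrite linear0. Qed.

Lemma quasi_iso_acyclic C D (f : chain_map C D) :
  quasi_iso f -> acyclic C <-> acyclic D.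
Proof.
move=> qf; split=> [aC n w cw|aD n z cz].
  case: (qf n) => _ /(_ w cw)[z [/aC[x xz] [y yw]]].
  exists (y + f _ x).
  by rewrite linearD -cmap_diff xz yw subrK.
by apply: (qf n).1 => //; apply: aD; exact: cycle_cmap.
Qed.

Lemma derived_iso_acyclic C D : derived_iso C D -> acyclic C <-> acyclic D.
Proof.
elim=> {C D} [C D f /quasi_iso_acyclic //|C D _ ->//|C D E _ -> _ -> //].
Qed.

Lemma zero_complex_acyclic : acyclic (zero_complex R).
Proof. by move=> n z _; exists 0; apply/rowP => -[]. Qed.

Definition to_zero_complex C : chain_map C (zero_complex R) :=
  @ChainMap R C (zero_complex R) (fun _ => \0) (fun _ _ _ => erefl).

(** A zigzag of quasi-isomorphisms preserves acyclicity, and conversely the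
zero map out of an acyclic complex is a quasi-isomorphism. *)
Lemma derived_zeroP C : derived_zero C <-> acyclic C.
Proof.
split=> [/derived_iso_acyclic -> |aC]; first exact: zero_complex_acyclic.
apply: (@derived_iso_qis _ _ _ (to_zero_complex C)) => n; split=> [z cz _|w _].
  exact: aC.
exists 0; split; first by rewrite /Defs.cycle linear0.
by exists 0; apply/rowP => -[].
Qed.

End Acyclic.

Section Bousfield.
Variable R : comPzRingType.
Implicit Types A P X : complex R.

Lemma bousfield_classP A X :
  bousfield_class A X <->
  exists P (f : chain_map P A),
    [/\ K_flat P, quasi_iso f & acyclic (tensor_complex P X)].
Proof.
split=> [[T [[P [f [fP qf TP]]] /derived_zeroP aT]]|[P [f [fP qf aP]]]].
  by exists P, f; split=> //; apply/(derived_iso_acyclic TP).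
have /derived_zeroP zP := aP.
exists (zero_complex R); split; last exact/derived_zeroP/zero_complex_acyclic.
by exists P, f; split=> //; exact: derived_iso_sym.
Qed.

End Bousfield.

(** * Words, diagrams and proofs from a diagram *)
Notation carrier X := (fun j : int => X j : Type).
Notation names := (fun _ : int => nat).

Section Words.
Variable R : comPzRingType.
Implicit Types T : int -> Type.

(** The equations that a family of symbols [T j], one for each degree, is
declared to satisfy: [rel_add a b c] stands for c = a + b, [rel_scale r a b]
for b = r a, and [rel_diff a b] for b = d a.  They are relations because only
finitely many of the symbols will denote anything. *)
Record diagram T := Diagram {
  rel_add : forall j, T j -> T j -> T j -> Prop;
  rel_scale : forall j, R -> T j -> T j -> Prop;
  rel_diff : forall j, T j -> T (j - 1) -> Prop
}.

Definition diagram_map T T' (D : diagram T) (D' : diagram T')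
    (f : forall j, T j -> T' j) : Prop :=
  [/\ forall j a b c, rel_add D (j := j) a b c ->
                      rel_add D' (f j a) (f j b) (f j c),
      forall j r a b, rel_scale D (j := j) r a b ->
                      rel_scale D' r (f j a) (f j b)
    & forall j a b, rel_diff D (j := j) a b -> rel_diff D' (f j a) (f _ b)].

Variable P : complex R.

(** A formal tensor of [lval] in P and [rval].  The total degree is not part of
the type, so that differentials need no casts; [homogeneous] imposes it on
words afterwards. *)
Record letter T := Letter {
  ldeg : int; rdeg : int; lval : P ldeg; rval : T rdeg
}.
Arguments Letter {T ldeg rdeg}.

Definition homogeneous T (n : int) (s : seq (letter T)) : bool :=
  all (fun l => ldeg l + rdeg l == n) s.

Definition rename T T' (f : forall j, T j -> T' j) (l : letter T) : letter T' :=
  Letter (lval l) (f _ (rval l)).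

Lemma homogeneous_rename T T' (f : forall j, T j -> T' j) n s :
  homogeneous n (map (rename f) s) = homogeneous n s.
Proof. by rewrite /homogeneous all_map. Qed.

(** The congruence that presents the tensor product, in which every relation
used in the right-hand factor must be supplied by the diagram. *)
Inductive derivable T (D : diagram T) :
    seq (letter T) -> seq (letter T) -> Prop :=
| der_refl s : derivable D s s
| der_sym s t : derivable D s t -> derivable D t s
| der_trans s t u : derivable D s t -> derivable D t u -> derivable D s u
| der_cat s s' t t' :
    derivable D s s' -> derivable D t t' -> derivable D (s ++ t) (s' ++ t')
| der_catC s t : derivable D (s ++ t) (t ++ s)
| der_addl i j (p p' : P i) (a : T j) :
    derivable D [:: Letter (p + p') a] [:: Letter p a; Letter p' a]
| der_addr i j (p : P i) (a b c : T j) : rel_add D a b c ->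
    derivable D [:: Letter p c] [:: Letter p a; Letter p b]
| der_scale i j r (p : P i) (a b : T j) : rel_scale D r a b ->
    derivable D [:: Letter (r *: p) a] [:: Letter p b]
| der_zero i j (a : T j) : derivable D [:: Letter (0 : P i) a] [::].

(** The Leibniz rule letter by letter.  It is a relation and not a function,
since a diagram may give a symbol no differential or several. *)
Inductive leibniz T (D : diagram T) :
    seq (letter T) -> seq (letter T) -> Prop :=
| leibniz_nil : leibniz D [::] [::]
| leibniz_cons i j (p : P i) (a : T j) b s t :
    rel_diff D a b -> leibniz D s t ->
    leibniz D (Letter p a :: s)
      [:: Letter (diff P i (i - 1) p) a, Letter ((-1) ^+ `|i|%N *: p) b & t].

Lemma derivable_map T T' (D : diagram T) (D' : diagram T') f s t :
  diagram_map D D' f -> derivable D s t ->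
  derivable D' (map (rename f) s) (map (rename f) t).
Proof.
case=> fa fs fd; elim=> {s t} /=.
- by move=> s; exact: der_refl.
- by move=> *; exact: der_sym.
- by move=> s t u _ st _ tu; exact: der_trans tu.
- by move=> *; rewrite !map_cat; exact: der_cat.
- by move=> *; rewrite !map_cat; exact: der_catC.
- by move=> *; exact: der_addl.
- by move=> *; apply/der_addr/fa.
- by move=> *; apply/der_scale/fs.
- by move=> *; exact: der_zero.
Qed.

Lemma leibniz_map T T' (D : diagram T) (D' : diagram T') f s t :
  diagram_map D D' f -> leibniz D s t ->
  leibniz D' (map (rename f) s) (map (rename f) t).
Proof.
case=> fa fs fd; elim=> {s t} /= [|i j p a b s t ab _ IHs].
  exact: leibniz_nil.
by apply: leibniz_cons => //; exact: fd.
Qed.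

Lemma homogeneous_leibniz T (D : diagram T) n m s t : n = m + 1 ->
  leibniz D s t -> homogeneous n s -> homogeneous m t.
Proof.
move=> nm; elim=> {s t} //= i j p a b s t _ _ IHs /andP[/eqP ij /IHs ->].
by rewrite andbT addrAC addrA ij nm addrK eqxx.
Qed.

Definition proves_cycle T (D : diagram T) (s : seq (letter T)) : Prop :=
  exists t, leibniz D s t /\ derivable D t [::].

(** Letters of [u] of the wrong degree have value 0 ([ctens_degree]), so [u]
denotes an element of degree n + 1 even if it is not homogeneous. *)
Definition proves_boundary T (D : diagram T) (s : seq (letter T)) : Prop :=
  exists u t, leibniz D u t /\ derivable D t s.

(** * Words in elements of X compute in the tensor complex *)
Section Elements.
Variable X : complex R.

(** The tautological diagram, in which every element of X is its own symbol. *)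
Definition elements : diagram (carrier X) :=
  Diagram (fun j (a b c : X j) => c = a + b) (fun j r (a b : X j) => b = r *: a)
    (fun j (a : X j) b => b = diff X j (j - 1) a).

Definition value (n : int) (s : seq (letter (carrier X))) : tensor_complex P X n :=
  \sum_(l <- s) ctens n (lval l) (rval l).

Lemma ctens_degree n i j (p : P i) (a : X j) : i + j != n -> ctens n p a = 0.
Proof. by rewrite /ctens; case: {-}_ / idP => // e /negP. Qed.

(** Soundness: each rule is an identity in the tensor product, also when the
letters do not have total degree [n] and all values are 0. *)
Lemma derivable_value n s t : derivable elements s t -> value n s = value n t.
Proof.
elim=> {s t} /=.
- by [].
- by [].
- by move=> s t u _ -> _ ->.
- by move=> s s' t t' _ es _ et; rewrite /value !big_cat /= -!/(value _ _) es et.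
- by move=> s t; rewrite /value !big_cat /= addrC.
- by move=> *; rewrite /value !big_cons !big_nil /= !addr0 ctens_addl.
- by move=> i j p a b c /= ->; rewrite /value !big_cons !big_nil /= !addr0 ctens_addr.
- by move=> i j r p a b /= ->; rewrite /value !big_cons !big_nil /= !addr0 ctensZl
    ctensZr.
- by move=> *; rewrite /value !big_cons !big_nil /= !addr0 ctens0l.
Qed.

Lemma leibniz_value n m s t : n = m + 1 -> leibniz elements s t ->
  diff (tensor_complex P X) n m (value n s) = value m t.
Proof.
move=> nm; elim=> {s t} /= [|i j p a b s t /= -> _ IHs].
  by rewrite /value !big_nil; exact: linear0.
have dE : tensor_diff P X n m (ctens n p a) =
    ctens m (diff P i (i - 1) p) a +
    ctens m ((-1) ^+ `|i|%N *: p) (diff X j (j - 1) a).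
  have [ij|/negP ij] := boolP (i + j == n).
    by rewrite (tensor_diff_ctens _ _ (eqP ij)) // ctensZl.
  have ijm : (i - 1 + j != m) && (i + (j - 1) != m).
    by rewrite addrA addrAC andbb addrAC subr_eq -nm; apply/negP.
  case/andP: ijm => ijm jim.
  by rewrite !ctens_degree ?linear0 ?addr0 //; apply/negP.
rewrite /value !big_cons /= in IHs *.
by rewrite linearD /= IHs dE addrA.
Qed.

Lemma leibniz_elements s : exists t, leibniz elements s t.
Proof.
elim: s => [|[i j p a] s [t st]]; first by exists [::]; exact: leibniz_nil.
by eexists; apply: (leibniz_cons p _ st); reflexivity.
Qed.

Definition tgen_letter n
    (g : tgen (fun ij : antidiag n => P (val ij).1)
              (fun ij : antidiag n => X (val ij).2)) : letter (carrier X) :=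
  Letter (tagged g).1 (tagged g).2.

Lemma value_tclass n s : value n (map (@tgen_letter n) s) = tclass s.
Proof.
rewrite tclassE /value big_map; apply: eq_bigr => -[ij [p a]] _ /=.
by rewrite -ctensE.
Qed.

Lemma homogeneous_tgen n s : homogeneous n (map (@tgen_letter n) s).
Proof. by elim: s => //= -[[ij e] [p a]] s ->; rewrite andbT. Qed.

Lemma homogeneous_lift n s :
  homogeneous n s -> exists s0, s = map (@tgen_letter n) s0.
Proof.
elim: s => [|[i j p a] s IHs]; first by exists [::].
move=> /= /andP[e /IHs[s0 ->]].
pose ij : antidiag n := exist _ (i, j) e.
by exists (@tg R (antidiag n) (fun ij => P (val ij).1)
                    (fun ij => X (val ij).2) ij p a :: s0).
Qed.

Lemma value_surj n (z : tensor_complex P X n) :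
  exists2 s, homogeneous n s & z = value n s.
Proof.
case: (tclass_surj z) => s ->; exists (map (@tgen_letter n) s).
  exact: homogeneous_tgen.
by rewrite value_tclass.
Qed.

(** The congruence of the tautological diagram contains the one by which the
tensor product is defined. *)
Lemma value_inj n s t : homogeneous n s -> homogeneous n t ->
  value n s = value n t -> derivable elements s t.
Proof.
move=> /homogeneous_lift[{}s ->] /homogeneous_lift[{}t ->].
rewrite !value_tclass => /tclassP; elim=> {s t} /=.
- by move=> *; exact: der_refl.
- by move=> *; exact: der_sym.
- by move=> s t u _ st _ tu; exact: der_trans tu.
- by move=> *; rewrite !map_cat; exact: der_cat.
- by move=> *; rewrite !map_cat; exact: der_catC.
- by move=> *; exact: der_addl.
- by move=> *; exact: der_addr.
- by move=> *; exact: der_scale.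
- by move=> *; exact: der_zero.
Qed.

End Elements.
End Words.

Arguments Letter {R P T ldeg rdeg}.

(** * Naming finitely many elements *)
Section Environments.
Variables (R : comPzRingType) (X : complex R).

(** A list of elements of X in each degree; the position of an element in its
list is its name.  Extending the lists at the end keeps the names. *)
Definition env := forall j, seq (X j).
Implicit Types x y : env.

Definition env_le x y : Prop := forall j, prefix (x j) (y j).

Lemma env_le_refl x : env_le x x.
Proof. by move=> j; exact: prefix_refl. Qed.

Lemma env_le_trans x y z : env_le x y -> env_le y z -> env_le x z.
Proof. by move=> xy yz j; exact: prefix_trans (xy j) (yz j). Qed.

Definition look x j (a : nat) : X j := nth 0 (x j) a.
Definition name x j (u : X j) : nat := index u (x j).

(** Equations are declared only between positions within the lists: beyond
them [look] returns the default 0, which an extension may overwrite. *)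
Definition env_diagram x : diagram R names :=
  Diagram
    (fun j a b c => [/\ (a < size (x j))%N, (b < size (x j))%N, (c < size (x j))%N &
                        look x j c = look x j a + look x j b])
    (fun j r a b => [/\ (a < size (x j))%N, (b < size (x j))%N &
                        look x j b = r *: look x j a])
    (fun j a b => [/\ (a < size (x j))%N, (b < size (x (j - 1)%R))%N &
                        look x _ b = diff X j (j - 1) (look x j a)]).

Lemma look_le x y j a : env_le x y -> (a < size (x j))%N ->
  look y j a = look x j a.
Proof. by move=> /(_ j) /prefixP[t e] ax; rewrite /look e nth_cat ax. Qed.

Lemma size_le x y j a : env_le x y -> (a < size (x j))%N -> (a < size (y j))%N.
Proof. by move=> /(_ j) /size_prefix xy /leq_trans; apply. Qed.

Lemma look_name x j u : u \in x j -> look x j (name x u) = u.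
Proof. exact: nth_index. Qed.

Lemma name_lt x j u : (name x u < size (x j))%N = (u \in x j).
Proof. exact: index_mem. Qed.

Lemma look_map x : diagram_map (env_diagram x) (elements X) (look x).
Proof. by split=> j > []. Qed.

(** [Q] holds as soon as enough elements have been named, whichever names were
given before and whatever is named afterwards.  In this form finitely many
requirements can be met one after the other, without keeping track of the list
of the elements that have to be named. *)
Definition eventually (Q : env -> Prop) : Prop :=
  forall x, exists2 y, env_le x y & forall z, env_le y z -> Q z.

Lemma eventuallyT (Q : env -> Prop) : (forall x, Q x) -> eventually Q.
Proof. by move=> QT x; exists x => //; exact: env_le_refl. Qed.

Lemma eventually_and (Q Q' : env -> Prop) :
  eventually Q -> eventually Q' -> eventually (fun x => Q x /\ Q' x).
Proof.
move=> eQ eQ' x; have [y xy yQ] := eQ x; have [z yz zQ] := eQ' y.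
exists z => [|t zt]; first exact: env_le_trans yz.
by split; [apply: yQ; exact: env_le_trans zt|exact: zQ].
Qed.

Lemma eventually_imply (Q Q' : env -> Prop) :
  (forall x, Q x -> Q' x) -> eventually Q -> eventually Q'.
Proof. by move=> QQ' eQ x; have [y xy yQ] := eQ x; exists y => // z /yQ/QQ'. Qed.

(** Append [u] to the list in degree [j].  [tagged_as] casts [u] to the degree
at hand, and appends a harmless 0 in the degrees other than [j]. *)
Lemma eventually_mem j (u : X j) : eventually (fun x => u \in x j).
Proof.
move=> x; pose g k := tagged_as (Tagged (carrier X) (0 : X k)) (Tagged (carrier X) u).
exists (fun k => x k ++ [:: g k]) => [k|z /(_ j)].
  exact: prefix_prefix.
move=> /prefixP[t ->]; rewrite !mem_cat mem_seq1.
have -> : g j = u by exact: (@tagged_asE _ _ (Tagged (carrier X) (0 : X j)) u).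
by rewrite eqxx orbT.
Qed.

Variable P : complex R.
Implicit Types s t : seq (letter P (carrier X)).

(** Compactness: a derivation mentions finitely many elements of X, and remains
valid once all of them are named. *)
Lemma eventually_derivable s t : derivable (elements X) s t ->
  eventually (fun x => derivable (env_diagram x)
    (map (rename (name x)) s) (map (rename (name x)) t)).
Proof.
elim=> {s t}.
- by move=> s; apply: eventuallyT => x; exact: der_refl.
- by move=> s t _; apply: eventually_imply => x; exact: der_sym.
- move=> s t u _ IHs _ /(eventually_and IHs).
  by apply: eventually_imply => x [st tu]; exact: der_trans tu.
- move=> s s' t t' _ IHs _ /(eventually_and IHs).
  by apply: eventually_imply => x [ss' tt']; rewrite !map_cat; exact: der_cat.
- by move=> s t; apply: eventuallyT => x; rewrite !map_cat; exact: der_catC.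
- by move=> i j p p' a; apply: eventuallyT => x; exact: der_addl.
- move=> i j p a b c /= cE.
  have := eventually_and (eventually_mem a)
    (eventually_and (eventually_mem b) (eventually_mem c)).
  apply: eventually_imply => x [ax [bx cx]].
  by apply: der_addr; rewrite /= !name_lt !look_name.
- move=> i j r p a b /= bE.
  have := eventually_and (eventually_mem a) (eventually_mem b).
  apply: eventually_imply => x [ax bx].
  by apply: der_scale; rewrite /= !name_lt !look_name.
- by move=> i j a; apply: eventuallyT => x; exact: der_zero.
Qed.

Lemma eventually_leibniz s t : leibniz (elements X) s t ->
  eventually (fun x => leibniz (env_diagram x)
    (map (rename (name x)) s) (map (rename (name x)) t)).
Proof.
elim=> {s t} [|i j p a b s t /= bE _ IHs].
  by apply: eventuallyT => x; exact: leibniz_nil.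
have := eventually_and IHs
  (eventually_and (eventually_mem a) (eventually_mem b)).
apply: eventually_imply => x [st [ax bx]].
by apply: leibniz_cons => //=; rewrite !name_lt !look_name.
Qed.

Definition in_range x (w : seq (letter P names)) : bool :=
  all (fun l => (rval l < size (x (rdeg l)))%N) w.

Lemma leibniz_in_range x w w' : leibniz (env_diagram x) w w' -> in_range x w.
Proof. by elim=> {w w'} //= i j p a b s t [-> _ _] _ ->. Qed.

(** An element may occupy several positions of its list.  The name in [w] and
the name chosen by [name] denote the same element, so 1 a = b relates them. *)
Lemma derivable_rename x y w : env_le x y -> in_range x w ->
  derivable (env_diagram y)
    (map (rename (name y)) (map (rename (look x)) w)) w.
Proof.
move=> xy; elim: w => [|[i j p a] w IHw] /=; first by move=> _; exact: der_refl.
move=> /andP[ax /IHw ww]; rewrite -[_ :: w]cat1s -cat1s.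
apply: der_cat => //; rewrite /rename /= -[p in X in derivable _ X]scale1r.
have ay := size_le xy ax.
have lay : look x j a \in y j by rewrite -(look_le xy ax) mem_nth.
by apply: der_scale; rewrite /= name_lt look_name // scale1r (look_le xy ax).
Qed.

Lemma look_rename x y s : env_le x y -> in_range x (map (rename (name x)) s) ->
  map (rename (look y)) (map (rename (name x)) s) = s.
Proof.
move=> xy; elim: s => //= -[i j p a] s IHs /= /andP[ax /IHs ->].
by rewrite /rename /= (look_le xy ax) look_name // -name_lt.
Qed.

End Environments.

(** * Spectra determine Bousfield classes *)
Section Spectrum.
Variable R : comPzRingType.
Implicit Types P X : complex R.

Definition profile_type := bool -> int -> diagram R names -> Prop.

(** The flag selects between diagrams proving a boundary ([true]) and a cycle
([false]).  The degree is recorded because equal values yield derivations only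
between homogeneous words ([value_inj]). *)
Definition profile P (w : seq (letter P names)) : profile_type :=
  fun b n D => homogeneous n w /\
    (if b then proves_boundary D w else proves_cycle D w).

Definition spectrum P (tau : profile_type) : Prop :=
  exists w : seq (letter P names), profile w = tau.

(** A cycle z of P (x) X is traded for a cycle of P' (x) X with the same profile;
the proof that the latter is a boundary is transported back. *)
Lemma spectrum_acyclic P P' X :
  (forall tau, spectrum P tau -> spectrum P' tau) ->
  acyclic (tensor_complex P' X) -> acyclic (tensor_complex P X).
Proof.
move=> PP' aP' n z cz.
have [s hs zE] := value_surj z.
have [t st] := leibniz_elements s.
have nE : n = (n - 1) + 1 by rewrite subrK.
have t0 : derivable (elements X) t [::].
  apply: (@value_inj _ _ _ (n - 1)) => //.
    exact: homogeneous_leibniz st hs.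
  by rewrite -(leibniz_value nE st) -zE cz /value big_nil.
(* [x] names enough elements of X for its diagram to prove z a cycle. *)
have [x _ /(_ _ (env_le_refl x))[lx dx]] :=
  eventually_and (eventually_leibniz st) (eventually_derivable t0) (fun=> [::]).
set w := map (rename (name x)) s in lx.
(* [w'] is a word over P' with the profile of the word [w] for z. *)
have [|w' ww'] := PP' (profile w); first by exists w.
have [hw' [t' [lt' dt']]] : profile w' false n (env_diagram x).
  by rewrite ww'; split; [rewrite homogeneous_rename|exists (map (rename (name x)) t)].
pose s' := map (rename (look x)) w'.
have : Defs.cycle (value n s').
  rewrite /Defs.cycle (leibniz_value nE (leibniz_map (look_map x) lt')).
  by rewrite (derivable_value _ (derivable_map (look_map x) dt')) /value big_nil.
case/aP' => y yE; have [u hu uE] := value_surj y.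
have [v uv] := leibniz_elements u.
have vs' : derivable (elements X) v s'.
  apply: (@value_inj _ _ _ n).
  - exact: homogeneous_leibniz uv hu.
  - by rewrite homogeneous_rename.
  - by rewrite -(leibniz_value (erefl (n + 1)) uv) -uE yE.
(* [x'] extends [x] and proves [w'] a boundary; so it proves [w] a boundary,
   and [w] still denotes z under [x']. *)
have [x' xx' /(_ _ (env_le_refl x'))[lx' dx']] :=
  eventually_and (eventually_leibniz uv) (eventually_derivable vs') x.
have : profile w' true n (env_diagram x').
  split=> //; eexists; eexists; split; first exact: lx'.
  apply: der_trans dx' _.
  exact: derivable_rename xx' (leibniz_in_range lt').
rewrite ww' => -[_ [q [q' [lq dq]]]].
have lq' := leibniz_map (look_map x') lq.
exists (value (n + 1) (map (rename (look x')) q)).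
rewrite (leibniz_value (erefl (n + 1)) lq')
  (derivable_value _ (derivable_map (look_map x') dq)).
by rewrite look_rename ?zE //; exact: leibniz_in_range lx.
Qed.

(** Taking all K-flat resolutions at once makes this an invariant of A, with no
comparison between different resolutions. *)
Definition resolution_spectra (A : complex R) (sigma : profile_type -> Prop) :
    Prop :=
  exists P (f : chain_map P A), [/\ K_flat P, quasi_iso f & spectrum P = sigma].

Lemma resolution_spectra_bousfield A B X :
  resolution_spectra A = resolution_spectra B ->
  bousfield_class A X -> bousfield_class B X.
Proof.
move=> AB /bousfield_classP[P [f [fP qf aP]]].
have [P' [f' [fP' qf' PP']]] : resolution_spectra B (spectrum P).
  by rewrite -AB; exists P, f.
apply/bousfield_classP; exists P', f'; split=> //.
by apply: spectrum_acyclic aP => tau; rewrite PP'.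
Qed.

End Spectrum.

Theorem corollary3p4 (R : comPzRingType) :
  exists (I : small_type) (F : I -> complex R),
    forall A : complex R, exists i : I, same_bousfield_class A (F i).
Proof.
pose I := (profile_type R -> Prop) -> Prop.
(* [F] picks a complex for each value of the invariant that is attained. *)
have /choice[F FE] : forall i : I, exists B : complex R,
    (exists A, resolution_spectra A = i) -> resolution_spectra B = i.
  move=> i.
  have [[A Ai]|no] := pselect (exists A, resolution_spectra A = i).
    by exists A.
  by exists (zero_complex R) => /no.
exists I, F => A; exists (resolution_spectra A) => X.
have e := FE _ (ex_intro _ A erefl).
by split; apply: resolution_spectra_bousfield.
Qed.
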